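(* Let $m \geq 2$ be an integer and let $W = \mathbb{F}_2^{2^m}$, the vector space of dimension $2^m$ over $\mathbb{F}_2$. If $G$ is a subgroup of $\mathrm{GL}(W)$ such that $G$ is isomorphic to $\mathrm{Alt}(\mathbb{F}_2^{128})$, then $m \geq 67$.
   Context: $\mathbb{F}_2$ is the field with two elements. For a vector space $V = \mathbb{F}_2^n$, $\mathrm{GL}(V)$ denotes the group of all linear permutations (invertible $\mathbb{F}_2$-linear maps) of $V$, and $\mathrm{Alt}(V)$ denotes the alternating group on the underlying set of $V$, i.e. the group of all even permutations of the $2^n$ vectors of $V$ (not necessarily linear). Thus $\mathrm{Alt}(\mathbb{F}_2^{128})$ is the alternating group on a set of $2^{128}$ elements. *)

(* Defs.v *)
From mathcomp Require Export all_boot all_order all_algebra all_fingroup all_solvable.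
Set Implicit Arguments.
Unset Strict Implicit.
Unset Printing Implicit Defensive.

(* [{'GL_n['F_2]}] is the finite group of units of 'M['F_2]_n.-1.+1; since
   0 < 2 ^ m, for n = 2 ^ m this is the general linear group of the space
   'rV['F_2]_(2 ^ m), in matrix form. *)

(* Main.v *)
Require Import Defs.
Set Implicit Arguments.
Unset Strict Implicit.
Unset Printing Implicit Defensive.
Local Open Scope group_scope.

(* Compare orders: GL_n(F_2) has at most 2^(n^2)
   elements, while the order (2^128)!/2 of the alternating group is at least
   (2^127)^(2^127)/2, whence 127 * 2^127 <= 2^(2m) + 1. *)

(** Since 127 exceeds 2^6, the bound of [Alt_sub_GL_dim] at k = 127, n = 2^m gives 2^133 <= 2^(2m) +
    1, which fails for m <= 66. *)

Lemma expn_leq_fact (a b : nat) : (b ^ a <= (a + b)`!)%N.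
Proof.
elim: a => [|a IHa]; first by rewrite expn0 fact_gt0.
by rewrite addSn factS expnS leq_mul // leqW // leq_addl.
Qed.

Lemma ltnS_double_exp2 (k : nat) : ((2 ^ k.+1).+1 < 2 * 2 ^ k.+1)%N.
Proof. by rewrite mul2n -addnn -addn1 ltn_add2l -[1%N](expn0 2) ltn_exp2l. Qed.

(** Invertible matrices are among all matrices; positivity of [n] makes their encoded size [n.-1.+1]
    equal to [n]. *)
Lemma card_GL_leq (F : finFieldType) (n : nat) :
  (0 < n)%N -> (#|{: {'GL_n[F]}}| <= #|F| ^ (n * n))%N.
Proof.
case: n => // n _; rewrite -card_mx.
exact: leq_card (@val_inj _ _ {'GL_n.+1[F]}).
Qed.

(** Base 2 logarithm of the comparison of orders; the successor on the right pays for the index 2 of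
    ['Alt_T] in the symmetric group. *)
Lemma Alt_sub_GL_dim (T : finType) (k n : nat) (G : {group {'GL_n['F_2]}}) :
  (0 < n)%N -> #|T| = (2 ^ k.+1)%N -> G \isog 'Alt_T ->
  (k * 2 ^ k <= (n * n).+1)%N.
Proof.
move=> n_gt0 cardT isoG; rewrite -(@leq_exp2l 2) // expnM expnS.
have T_gt1 : (1 < #|T|)%N by rewrite cardT -[1%N](expn0 2) ltn_exp2l.
have leGL : (#|'Alt_T| <= 2 ^ (n * n))%N.
  rewrite -(card_isog isoG); apply: leq_trans (max_card _) _.
  by have := card_GL_leq 'F_2 n_gt0; rewrite card_Fp.
apply: leq_trans (_ : #|T|`! <= _)%N.
  (* Split #|T| as 2^k + 2^k: the upper half of the factors of the factorial all exceed 2^k. *)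
  by rewrite cardT expnS mul2n -addnn expn_leq_fact.
by rewrite -card_Alt // leq_mul2l.
Qed.

Theorem proposition2 (m : nat) (hm : (2 <= m)%N)
    (G : {group {'GL_(2 ^ m)%N['F_2]}})
    (hG : G \isog 'Alt_('rV['F_2]_128)) :
  (67 <= m)%N.
Proof.
have cardV : #|{: 'rV['F_2]_128}| = (2 ^ 127.+1)%N.
  by rewrite card_mx card_Fp // mul1n.
have m2_gt0 : (0 < 2 ^ m)%N by rewrite expn_gt0.
have le_dim := Alt_sub_GL_dim m2_gt0 cardV hG.
rewrite leqNgt; apply/negP => m_lt67.
have : (2 ^ 133 <= (2 ^ 132).+1)%N.
  apply: leq_trans (_ : _ <= 127 * 2 ^ 127)%N _.
    (* 2^6 = 64 <= 127. *)
    by rewrite -[133]/(6 + 127)%N expnD leq_mul2r orbT.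
  apply: leq_trans le_dim _; rewrite ltnS -expnD leq_exp2l //.
  exact: (@leq_add m m 66 66).
by rewrite (expnS 2 132) leqNgt ltnS_double_exp2.
Qed.
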